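(* Let $(\mathcal{V},\mathfrak{A})$ be a $t$-$(v,k,\Gamma,m,\lambda_t)$ resolvable design and let $q=v/k$. Then the dual design of $(\mathcal{V},\mathfrak{A})$, with the $m$ parallel classes of $\mathfrak{A}$ as its groups, is a $t$-$(m,q,m,\lambda_t)$ GDD.
   Context: A design is a pair $(\mathcal{V},\mathfrak{A})$ where $\mathcal{V}$ is a set of points and $\mathfrak{A}$ is a collection (family) of non-empty subsets of $\mathcal{V}$, called blocks (repeated blocks are counted as distinct members of the family). It is resolvable if $\mathfrak{A}$ can be divided into parallel classes such that the blocks in each class partition $\mathcal{V}$. A resolvable design is $t$-cross if the intersection of any $t$ blocks drawn from any $t$ distinct parallel classes has the same size $\lambda_t$. A $t$-$(v,k,\Gamma,m,\lambda_t)$ resolvable design is a $t$-cross resolvable design with $|\mathcal{V}|=v$, with $\Gamma$ blocks each of size $k$, divided into $m$ parallel classes $\mathfrak{A}=\mathfrak{A}_1\cup\dots\cup\mathfrak{A}_m$ ($1\le t\le m$), and with $t$-th cross intersection number $\lambda_t$. The dual design of $(\mathcal{V},\mathfrak{A})$ is the design $(\mathcal{X},\mathfrak{B})$ whose points are the blocks of $\mathfrak{A}$ and whose blocks are indexed by the points of $\mathcal{V}$: the block corresponding to $a\in\mathcal{V}$ is $\{\mathcal{A}\in\mathfrak{A} : a\in\mathcal{A}\}$. For positive integers $t\le L\le m$ and $q$, a $t$-$(m,q,L,\lambda)$ GDD is a triple $(\mathcal{X},\mathfrak{G},\mathfrak{B})$ where $\mathcal{X}$ is a set of $mq$ points; $\mathfrak{G}=\{\mathcal{G}_1,\dots,\mathcal{G}_m\}$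 is a partition of $\mathcal{X}$ into $m$ subsets (groups) of size $q$; and $\mathfrak{B}$ is a family of $L$-subsets of $\mathcal{X}$ (blocks) such that every block meets every group in at most one point, and every $t$-subset of points from $t$ distinct groups is contained in exactly $\lambda$ blocks (counted with multiplicity in the family). *)

(* Defs.v *)
(* MathComp *)
From mathcomp Require Export all_boot.

Set Implicit Arguments.
Unset Strict Implicit.
Unset Printing Implicit Defensive.

(* A family of subsets of V is a map blk : I -> {set V} from a finite index   *)
(* type: distinct indices are distinct members of the family, even when the   *)
(* underlying subsets coincide.                                               *)
Definition is_design (V I : finType) (blk : I -> {set V}) : Prop :=
  forall i, blk i != set0.

(* Injectivity is needed because taking the image set forgets repetitions.    *)
Definition parallel_class (V I : finType) (blk : I -> {set V})
    (C : {set I}) : Prop :=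
  {in C &, injective blk} /\ partition [set blk i | i in C] [set: V].

Definition resolution (V I : finType) (blk : I -> {set V})
    (Q : {set {set I}}) : Prop :=
  partition Q [set: I] /\ (forall C, C \in Q -> parallel_class blk C).

(* When Q is a partition, this says that the elements of S lie in #|S|        *)
(* distinct members of Q.                                                     *)
Definition at_most_one_per_part (X : finType) (Q : {set {set X}})
    (S : {set X}) : Prop :=
  forall G, G \in Q -> #|S :&: G| <= 1.

Definition cross (V I : finType) (blk : I -> {set V}) (Q : {set {set I}})
    (t lam : nat) : Prop :=
  forall S : {set I}, #|S| = t -> at_most_one_per_part Q S ->
    #|\bigcap_(i in S) blk i| = lam.

Record resolvable_design (t v k Gamma m lam : nat) (V I : finType)
    (blk : I -> {set V}) (Q : {set {set I}}) : Prop := ResolvableDesign {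
  rd_t : 1 <= t <= m;
  rd_design : is_design blk;
  rd_points : #|V| = v;
  rd_blocks : #|I| = Gamma;
  rd_block_size : forall i, #|blk i| = k;
  rd_resolution : resolution blk Q;
  rd_classes : #|Q| = m;
  rd_cross : cross blk Q t lam
}.

Definition dual_design (V I : finType) (blk : I -> {set V}) : V -> {set I} :=
  fun a => [set i | a \in blk i].

Record GDD (t m q L lam : nat) (X J : finType) (Gs : {set {set X}})
    (blk : J -> {set X}) : Prop := GDDesign {
  gdd_params : [/\ 0 < t, t <= L, L <= m & 0 < q];
  gdd_points : #|X| = m * q;
  gdd_partition : partition Gs [set: X];
  gdd_groups : #|Gs| = m;
  gdd_group_size : forall G, G \in Gs -> #|G| = q;
  gdd_block_size : forall j, #|blk j| = L;
  gdd_block_group : forall j, at_most_one_per_part Gs (blk j);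
  gdd_balance : forall S : {set X}, #|S| = t -> at_most_one_per_part Gs S ->
    #|[set j | S \subset blk j]| = lam
}.

(* Main.v *)
Require Import Defs.
From mathcomp Require Import all_boot.

(** Each class cuts the [v] points into blocks of size [k], so every group has [v %/ k] elements. A
    point lies in exactly one block of each class, so its dual block is a transversal of the [m]
    groups. Finally, incidence is symmetric: the points whose dual blocks contain [S] are the common
    points of the blocks in [S], which turns the cross condition into the balance condition. *)

Lemma card_parallel_class (V I : finType) (blk : I -> {set V}) (C : {set I})
    (k : nat) :
  (forall i, #|blk i| = k) -> parallel_class blk C -> #|V| = #|C| * k.
Proof.
move=> blk_k [inj_blk partC]; rewrite -(card_in_imset inj_blk) -cardsT.
by apply: card_uniform_partition partC => _ /imsetP[i _ ->].
Qed.

Lemma parallel_class_dual (V I : finType) (blk : I -> {set V}) (C : {set I})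
    (a : V) :
  parallel_class blk C -> #|dual_design blk a :&: C| = 1.
Proof.
case=> inj_blk /and3P[/eqP covC /trivIsetP tiC _].
have: a \in cover [set blk i | i in C] by rewrite covC inE.
case/bigcupP=> _ /imsetP[i iC ->] ai.
suff ->: dual_design blk a :&: C = [set i] by rewrite cards1.
apply/setP=> j; rewrite !inE; apply/andP/eqP=> [[aj jC]|->] //.
(* Two blocks of [C] through [a] are equal as sets, by disjointness; injectivity then identifies
   their indices. *)
apply: inj_blk => //; apply/eqP; apply: contraLR aj => neq_ji.
by rewrite (disjointFl (tiC _ _ _ _ neq_ji) ai) ?imset_f.
Qed.

(** Counting the dual block along the partition [Q], each class contributes exactly 1. *)
Lemma card_dual_block (V I : finType) (blk : I -> {set V})
    (Q : {set {set I}}) (a : V) :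
  resolution blk Q -> #|dual_design blk a| = #|Q|.
Proof.
case=> partQ parQ; rewrite -[dual_design _ _]setTI -!sum1_card.
rewrite (eq_bigl _ _ (fun i => in_setI i _ _)) (set_partition_big_cond _ partQ).
apply: eq_bigr => C /parQ parC.
rewrite -[RHS](parallel_class_dual _ _ _ _ a parC).
by rewrite -sum1_card; apply: eq_bigl => i; rewrite in_setI andbC.
Qed.

Lemma dual_superblocks (V I : finType) (blk : I -> {set V}) (S : {set I}) :
  [set a | S \subset dual_design blk a] = \bigcap_(i in S) blk i.
Proof.
apply/setP=> a; rewrite inE; apply/subsetP/bigcapP=> sub i /sub;
  by rewrite inE.
Qed.

Theorem lemma5 (t v k Gamma m lam : nat) (V I : finType)
    (A : I -> {set V}) (classes : {set {set I}}) :
  resolvable_design t v k Gamma m lam A classes ->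
  GDD t m (v %/ k) m lam classes (dual_design A).
Proof.
case=> /andP[t_gt0 le_tm] desA cardV _ blk_k resA cardQ crossA.
have [partQ parQ] := resA; have [_ _ set0Q] := and3P partQ.
(* A class exists because [m >= t >= 1]. It is nonempty, which yields [0 < q], and any of its blocks
   shows [0 < k], so that dividing by [k] is exact rather than the default value 0. *)
have [C0 C0Q]: exists C0, C0 \in classes.
  by apply/card_gt0P; rewrite cardQ (leq_trans t_gt0).
have C0_gt0: 0 < #|C0| by rewrite card_gt0; apply: contraNneq set0Q => <-.
have k_gt0: 0 < k.
  by have /card_gt0P[i _] := C0_gt0; rewrite -(blk_k i) card_gt0 desA.
have classq C: C \in classes -> #|C| = v %/ k.
  move=> CQ; rewrite -cardV (card_parallel_class _ _ _ _ _ blk_k (parQ C CQ)).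
  by rewrite mulnK.
split=> //.
- by rewrite -(classq C0).
- by rewrite -cardsT -cardQ; apply: card_uniform_partition partQ.
- by move=> a; rewrite (card_dual_block _ _ _ _ a resA).
- by move=> a C CQ; rewrite parallel_class_dual //; apply: parQ.
- by move=> S cardS crossS; rewrite dual_superblocks crossA.
Qed.
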